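(* Let $f\in\mathbb{R}[x]_{2d}$ with $\inf_{x\in\mathbb{R}^n}f(x)>-\infty$, let $\varepsilon>0$ and let $k\in\mathbb{N}$. Let $$\rho_k^1(\varepsilon):=\sup\{\lambda\in\mathbb{R}:\ \theta^k(f-\lambda+\varepsilon\theta^d)\in\Sigma[x]_{k+d}\}$$ and let $\tau_k^1(\varepsilon)$ be the optimal value of its dual semidefinite program $$\tau_k^1(\varepsilon):=\inf\{L_y(\theta^k(f+\varepsilon\theta^d)):\ y=(y_\alpha)_{\alpha\in\mathbb{N}^n_{2(d+k)}}\subset\mathbb{R},\ M_{k+d}(y)\succeq0,\ L_y(\theta^k)=1\}.$$ Then $\rho_k^1(\varepsilon)=\tau_k^1(\varepsilon)$. Moreover, if $\tau_k^1(\varepsilon)>-\infty$ then the optimal value $\rho_k^1(\varepsilon)$ is attained.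
   Context: $x=(x_1,\dots,x_n)$; $\mathbb{N}$ contains $0$; $\theta(x):=1+\|x\|_2^2$; $\mathbb{R}[x]_t$ is the set of real polynomials of degree at most $t$; $\Sigma[x]_t$ is the set of sums of squares of real polynomials that have degree at most $2t$. $\mathbb{N}^n_t:=\{\alpha\in\mathbb{N}^n:|\alpha|\le t\}$ with $|\alpha|=\alpha_1+\dots+\alpha_n$. For a real sequence $y=(y_\alpha)$, $L_y(\sum_\alpha p_\alpha x^\alpha):=\sum_\alpha p_\alpha y_\alpha$ (Riesz functional) and $M_t(y):=(y_{\alpha+\beta})_{\alpha,\beta\in\mathbb{N}^n_t}$ (moment matrix); $\succeq0$ means positive semidefinite. $\sup\emptyset=-\infty$. ''$\rho_k^1(\varepsilon)$ is attained'' means the supremum defining it is a maximum. *)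

(* Defs.v *)
From HB Require Import structures.
From mathcomp Require Import all_boot all_order all_algebra.
From mathcomp Require Import boolp classical_sets reals.
(* The notation '\bar of constructive_ereal cannot be imported together with
   the notations of mpoly, hence EFin x for x%:E, ENInf R for -oo,
   extended R for \bar R. *)
From mathcomp Require Import -(notations) constructive_ereal ereal.
From mathcomp Require Import mpoly.

Set Implicit Arguments.
Unset Strict Implicit.
Unset Printing Implicit Defensive.

Import Order.TTheory GRing.Theory Num.Theory.

Local Open Scope ring_scope.
Local Open Scope classical_set_scope.

(* R[x]_t; recall that msize is 1 + degree, and 0 for the zero polynomial. *)
Definition poly_deg_le (R : realType) (n t : nat) : set {mpoly R[n]} :=
  [set p | (msize p <= t.+1)%N].

(* Sigma[x]_t *)
Definition sos (R : realType) (n t : nat) : set {mpoly R[n]} :=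
  [set p | poly_deg_le (2 * t) p /\
           exists s : seq {mpoly R[n]}, p = \sum_(q <- s) q ^+ 2].

Definition theta (R : realType) (n : nat) : {mpoly R[n]} :=
  1 + \sum_(i < n) 'X_i ^+ 2.

(* Real sequences indexed by the exponents of total degree at most b. *)
Definition trunc_seq (R : realType) (n b : nat) : Type :=
  {ffun 'X_{1..n < b.+1} -> R}.

(* Meaningful only for p of degree at most b: the coefficients of p at
   exponents of larger degree are ignored. *)
Definition riesz (R : realType) (n b : nat) (y : trunc_seq R n b)
    (p : {mpoly R[n]}) : R :=
  \sum_(m : 'X_{1..n < b.+1}) p@_m * y m.

Fact bmnm_add_proof (n t : nat) (a b : 'X_{1..n < t.+1}) :
  (mdeg (a + b)%MM < (2 * t).+1)%N.
Proof.
by rewrite mdegD ltnS mul2n -addnn leq_add // -ltnS bmdeg.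
Qed.

Definition bmnm_add (n t : nat) (a b : 'X_{1..n < t.+1}) :
  'X_{1..n < (2 * t).+1} := BMultinom (bmnm_add_proof a b).

(* Rows and columns are numbered through the enumeration of the exponents of
   total degree at most t. *)
Definition moment_mx (R : realType) (n t : nat) (y : trunc_seq R n (2 * t)) :
    'M[R]_#|{: 'X_{1..n < t.+1}}| :=
  \matrix_(i, j) y (bmnm_add (enum_val i) (enum_val j)).

Definition psdmx (R : realType) (m : nat) (A : 'M[R]_m) : Prop :=
  A^T = A /\ forall v : 'rV[R]_m, 0 <= (v *m A *m v^T) 0 0.

Definition rho_feasible (R : realType) (n d k : nat) (f : {mpoly R[n]})
    (eps : R) : set R :=
  [set l | sos (k + d)
             (theta R n ^+ k * (f - l%:MP + eps *: theta R n ^+ d))].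

Definition rho (R : realType) (n d k : nat) (f : {mpoly R[n]}) (eps : R) :
    extended R :=
  ereal_sup [set EFin l | l in rho_feasible d k f eps].

Definition tau_feasible (R : realType) (n d k : nat) :
    set (trunc_seq R n (2 * (k + d))) :=
  [set y | psdmx (moment_mx y) /\ riesz y (theta R n ^+ k) = 1].
Arguments tau_feasible : clear implicits.

Definition tau (R : realType) (n d k : nat) (f : {mpoly R[n]}) (eps : R) :
    extended R :=
  ereal_inf [set EFin (riesz y (theta R n ^+ k * (f + eps *: theta R n ^+ d)))
            | y in tau_feasible R n d k].

(* Main.v *)
Require Import Defs.
From HB Require Import structures.
From mathcomp Require Import all_boot all_order all_algebra.
From mathcomp Require Import boolp classical_sets reals.
From mathcomp Require Import -(notations) constructive_ereal ereal.
From mathcomp Require Import ring lra.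
From mathcomp Require topology normedtype derive.

(** Write a = theta^k, b = theta^k (f + eps theta^d), and let C be the cone of
sums of squares of degree at most 2(k+d). The primal asks for the largest l
with b - l a in C, the dual for the least L(b) over the functionals L that are
nonnegative on C and satisfy L(a) = 1.

Weak duality (weak_duality) is the evaluation of L on b - l a, once one knows
that a sum of squares of degree at most 2t only involves squares of polynomials
of degree at most t (sum_sqr_deg): the leading coefficients are squares, so they
cannot cancel.

For the converse, let r be any lower bound of the dual values; then b - r a is
in C (rho_feasible_lower_bound), so that both equality and attainment follow
by taking for r the dual optimal value. Otherwise some y with a psd moment
matrix would have L_y(b - r a) < 0 (sos_alternative). If L_y(a) > 0, rescaling y
gives a dual feasible point of value below r. If L_y(a) = 0, then L_y(b) < 0,
and adding large multiples of y to a dual feasible point sends the value to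
-oo. A dual feasible point is the evaluation at the origin, where theta = 1.
The sign L_y(a) >= 0 holds because theta^k is itself a sum of squares.

The theorem of the alternative sos_alternative is where compactness enters.
Sums of squares are the images of psd Gram matrices G under the linear map A
that sends G to sum_(a, c) G_ac x^(a+c), and A G = 0 forces G = 0 because a sum
of squares vanishes only if all its terms do. Hence if p is not of the form
A G, the map G |-> A G - (1 - tr G) p has no zero on the compact convex set of
psd G with tr G <= 1. The point of least norm of the image of this set then
gives the separating functional (convex_image_separation,
psd_alternative). *)

Set Implicit Arguments.
Unset Strict Implicit.
Unset Printing Implicit Defensive.

Import Order.TTheory GRing.Theory Num.Theory.

Local Open Scope ring_scope.
Local Open Scope classical_set_scope.

(** * Positive semidefinite forms on a finite type *)

Definition psd_form (R : rcfType) (T : finType) (G : T -> T -> R) : Prop :=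
  (forall a b, G a b = G b a) /\
  forall v : T -> R, 0 <= \sum_a \sum_b v a * v b * G a b.

Lemma sum_delta (R : rcfType) (T : finType) (h : T -> R) a :
  \sum_c (c == a)%:R * h c = h a.
Proof.
rewrite (bigD1 a) //= eqxx mul1r big1 ?addr0 // => c /negPf ->.
by rewrite mul0r.
Qed.

Lemma sum_shift (R : rcfType) (T : finType) (v h : T -> R) a s :
  \sum_c (v c + s * (c == a)%:R) * h c = \sum_c v c * h c + s * h a.
Proof.
rewrite -(sum_delta h a) mulr_sumr -big_split /=.
by apply: eq_bigr => c _; rewrite mulrDl mulrA.
Qed.

(** Value of the form at v + s e_a. Suitable choices of v and s yield the
elementary bounds on the entries. *)
Lemma psd_form_shift (R : rcfType) (T : finType) (G : T -> T -> R) v a s :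
  psd_form G ->
  0 <= \sum_b v b * (\sum_c v c * G b c)
       + 2 * s * (\sum_b v b * G a b) + s ^+ 2 * G a a.
Proof.
case=> symG /(_ (fun c => v c + s * (c == a)%:R)).
under eq_bigr do under eq_bigr do rewrite -mulrA.
under eq_bigr do rewrite -mulr_sumr sum_shift.
rewrite sum_shift; under eq_bigr do rewrite mulrDr (mulrCA _ s).
have -> : \sum_b v b * G a b = \sum_b v b * G b a.
  by apply: eq_bigr => b _; rewrite symG.
rewrite big_split -mulr_sumr /=.
by move=> h; lra.
Qed.

Lemma psd_form2 (R : rcfType) (T : finType) (G : T -> T -> R) a b s :
  psd_form G -> 0 <= G a a + 2 * s * G a b + s ^+ 2 * G b b.
Proof.
move=> pG; have := psd_form_shift (fun c => (c == a)%:R) b s pG.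
under eq_bigr do rewrite sum_delta.
by rewrite !sum_delta; case: pG => /(_ b a) ->.
Qed.

Lemma psd_form_diag (R : rcfType) (T : finType) (G : T -> T -> R) a :
  psd_form G -> 0 <= G a a.
Proof. by move=> /(psd_form2 a a 0) h; lra. Qed.

Lemma psd_form_le (R : rcfType) (T : finType) (G : T -> T -> R) a b :
  psd_form G -> 2 * `|G a b| <= G a a + G b b.
Proof.
move=> pG; have := psd_form2 a b 1 pG; have := psd_form2 a b (-1) pG.
by move=> h1 h2; have [?|?] := ler0P (G a b); lra.
Qed.

(** With G a a = 0 the value at e_b + s e_a is affine in s, so its slope must
vanish. *)
Lemma psd_form_row0 (R : rcfType) (T : finType) (G : T -> T -> R) a b :
  psd_form G -> G a a = 0 -> G a b = 0.
Proof.
move=> pG Ga.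
have h s := psd_form2 b a s pG.
have [/eqP//|nz] := boolP (G a b == 0).
case: (pG) => symG _.
(* this s makes the value at e_b + s e_a equal to -1 *)
have := h (- (G b b + 1) / (2 * G a b)).
rewrite Ga mulr0 addr0 (symG b a).
have -> : G b b + 2 * (- (G b b + 1) / (2 * G a b)) * G a b = -1.
  by field.
by lra.
Qed.

(** Symmetric Gaussian elimination: as long as some diagonal entry G a a is
nonzero, subtracting the rank-one form w w^T with w = G_a / sqrt (G a a) leaves
a psd form (minimise over s in psd_form_shift) with one more zero on the
diagonal. Once the diagonal is zero, so is G, by psd_form_row0. *)
Lemma psd_form_sum_rank1 (R : rcfType) (T : finType) (G : T -> T -> R) :
  psd_form G ->
  exists s : seq (T -> R), forall a b, G a b = \sum_(v <- s) v a * v b.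
Proof.
have [m] := ubnP #|[set a | G a a != 0]|%SET.
elim: m => // m IH in G *; rewrite ltnS => leG pG.
have [[a Ga]|none] := pselect (exists a, G a a != 0); last first.
  exists [::] => a b; rewrite big_nil psd_form_row0 //.
  by apply/eqP/negPn/negP => ?; apply: none; exists a.
have Ga0 : 0 < G a a by rewrite lt_def Ga psd_form_diag.
case: (pG) => symG _.
pose r := Num.sqrt (G a a).
have r2 : r ^+ 2 = G a a by rewrite sqr_sqrtr ?ltW.
have r0 : r != 0 by rewrite sqrtr_eq0 -ltNge.
pose w b := G a b / r.
pose G' b c := G b c - w b * w c.
have ww b c : w b * w c = G a b * G a c / G a a.
  by rewrite /w mulrACA -invfM -expr2 r2.
have pG' : psd_form G'.
  split=> [b c|v]; first by rewrite /G' symG mulrC.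
  pose u := \sum_b v b * G a b.
  have -> : \sum_b \sum_c v b * v c * G' b c =
      \sum_b v b * (\sum_c v c * G b c) - u ^+ 2 / G a a.
    under eq_bigr do under eq_bigr do rewrite /G' ww mulrBr.
    under eq_bigr do rewrite sumrB; rewrite sumrB; congr (_ - _).
      by under eq_bigr do under eq_bigr do rewrite -mulrA;
         under eq_bigr do rewrite -mulr_sumr.
    rewrite expr2 {1}/u mulr_suml mulr_suml; apply: eq_bigr => b _.
    rewrite /u mulr_sumr mulr_suml; apply: eq_bigr => c _; ring.
  have := psd_form_shift v a (- (u / G a a)) pG.
  by congr (0 <= _); rewrite -/u; field.
have card_G' : (#|[set b | G' b b != 0%R]|%SET < m)%N.
  apply: leq_trans leG; apply: proper_card; apply/properP; split.
    apply/fintype.subsetP => b; rewrite !inE; apply: contraNN => /eqP Gb.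
    have Gab : G a b = 0 by rewrite symG psd_form_row0.
    by rewrite /G' ww Gb Gab !mul0r subr0.
  by exists a; rewrite !inE // negbK /G' ww mulfK // subrr.
have [s sE] := IH G' card_G' pG'.
by exists (w :: s) => b c; rewrite big_cons -sE /G' addrC subrK.
Qed.

Lemma psd_formD (R : rcfType) (T : finType) (G H : T -> T -> R) l m :
  0 <= l -> 0 <= m -> psd_form G -> psd_form H ->
  psd_form (fun a b => l * G a b + m * H a b).
Proof.
move=> l0 m0 [sG pG] [sH pH]; split=> [a b|v]; first by rewrite sG sH.
have -> : \sum_a \sum_b v a * v b * (l * G a b + m * H a b) =
    l * (\sum_a \sum_b v a * v b * G a b) + m * \sum_a \sum_b v a * v b * H a b.
  rewrite !mulr_sumr -big_split; apply: eq_bigr => a _ /=.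
  by rewrite !mulr_sumr -big_split; apply: eq_bigr => b _ /=; ring.
by rewrite addr_ge0 // mulr_ge0.
Qed.

Lemma psd_form0 (R : rcfType) (T : finType) : psd_form (fun _ _ : T => 0 : R).
Proof.
by split=> // v; apply: sumr_ge0 => a _; apply: sumr_ge0 => b _; rewrite mulr0.
Qed.

Lemma psd_formZ (R : rcfType) (T : finType) (G : T -> T -> R) l :
  0 <= l -> psd_form G -> psd_form (fun a b => l * G a b).
Proof.
move=> l0 pG; have := psd_formD l0 (lexx 0) pG (psd_form0 R T).
by congr psd_form; apply/funext => a; apply/funext => b; rewrite mul0r addr0.
Qed.

Definition form_trace (R : rcfType) (T : finType) (G : T -> T -> R) : R :=
  \sum_a G a a.

Lemma psd_form_le_trace (R : rcfType) (T : finType) (G : T -> T -> R) a b :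
  psd_form G -> `|G a b| <= form_trace G.
Proof.
move=> pG; have h := psd_form_le a b pG.
have le_tr c : G c c <= form_trace G.
  rewrite /form_trace (bigD1 c) //= lerDl sumr_ge0 // => e _.
  exact: psd_form_diag.
have := le_tr a; have := le_tr b; lra.
Qed.

(** * Separation over compact convex sets *)

Section Separation.
Import topology normedtype derive numFieldNormedType.Exports.

Lemma continuous_sumr (R : realType) (X : topologicalType) (I : finType)
    (f : I -> X -> R) :
  (forall i, continuous (f i)) -> continuous (fun x => \sum_i f i x).
Proof.
by move=> cf; apply: continuous_big => //; move=> x; apply: add_continuous.
Qed.

Lemma continuous_subr (R : realType) (X : topologicalType) (f g : X -> R) :
  continuous f -> continuous g -> continuous (fun x => f x - g x).
Proof. by move=> cf cg x; apply: cvgB; [exact: cf|exact: cg]. Qed.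

Lemma continuous_mulr (R : realType) (X : topologicalType) (f g : X -> R) :
  continuous f -> continuous g -> continuous (fun x => f x * g x).
Proof. by move=> cf cg x; apply: cvgM; [exact: cf|exact: cg]. Qed.

(** If F c is a point of least norm of the convex image, then the inner product
with F c is positive on the image: were <F x, F c> <= 0, moving from F c
towards F x would decrease the norm. *)
Lemma convex_image_separation (R : realType) (X : topologicalType)
    (J : finType) (B : set X) (F : X -> J -> R) :
  compact B -> B !=set0 -> (forall j, continuous (F^~ j)) ->
  (forall x x' l, B x -> B x' -> 0 <= l <= 1 ->
     exists2 z, B z & forall j, F z j = (1 - l) * F x j + l * F x' j) ->
  (forall x, B x -> exists j, F x j != 0) ->
  exists y : J -> R, forall x, B x -> 0 < \sum_j F x j * y j.
Proof.
move=> cB B0 cF convF nz.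
have cN : continuous (fun x => \sum_j F x j ^+ 2).
  by apply: continuous_sumr => j; apply: continuous_mulr; apply: cF.
have [|c cB' cmin] := @compact_EVT_min X R (fun x => \sum_j F x j ^+ 2) B B0 cB.
  by apply: continuous_subspaceT.
have {}cB' : B c by rewrite inE in cB'.
exists (F c) => x Bx.
pose a := \sum_j F c j ^+ 2.
pose e := \sum_j F x j ^+ 2.
pose m := \sum_j F x j * F c j.
have e0 : 0 <= e by apply: sumr_ge0 => j _; apply: sqr_ge0.
have a0 : 0 < a.
  have [j Fj] := nz c cB'.
  rewrite /a (bigD1 j) //= ltr_pwDl ?exprn_even_gt0 //.
  by apply: sumr_ge0 => i _; apply: sqr_ge0.
rewrite -/m ltNge; apply/negP => m0.
(* l minimises the bound (1 - l)^2 a + l^2 e on the squared norm *)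
pose l := a / (a + e).
have ae : 0 < a + e by lra.
have lE : l * (a + e) = a by rewrite /l divfK // gt_eqF.
have l0 : 0 <= l by rewrite /l divr_ge0 // ltW.
have l1 : l <= 1 by rewrite /l ler_pdivrMr //; lra.
have [z Bz zE] := convF c x l cB' Bx (introT andP (conj l0 l1)).
have := cmin z (mem_set Bz).
have -> : \sum_j F z j ^+ 2 =
    (1 - l) ^+ 2 * a + 2 * l * (1 - l) * m + l ^+ 2 * e.
  rewrite /a /m /e !mulr_sumr -!big_split /=.
  by apply: eq_bigr => j _; rewrite zE; ring.
rewrite -/a; apply/negP; rewrite -ltNge.
have la0 : 0 < l * a by rewrite mulr_gt0 // /l divr_gt0.
have lm0 : 0 <= l * (1 - l) * - m.
  rewrite mulr_ge0 ?oppr_ge0 // mulr_ge0 // subr_ge0 //.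
have -> : (1 - l) ^+ 2 * a + 2 * l * (1 - l) * m + l ^+ 2 * e =
    a - 2 * (l * a) - 2 * (l * (1 - l) * - m) + l * (l * (a + e)) by ring.
rewrite lE; lra.
Qed.

Lemma closed_forall (X : topologicalType) (I : Type) (P : I -> X -> Prop) :
  (forall i, closed [set x | P i x]) -> closed [set x | forall i, P i x].
Proof.
move=> cP.
have := @closed_bigI X I setT (fun i => [set x | P i x]) (fun i _ => cP i).
congr closed; apply/seteqP; split => x /= h i //; first exact: h.
by move=> _; exact: h.
Qed.

Lemma closed_le_continuous (R : realType) (X : topologicalType) (f g : X -> R) :
  continuous f -> continuous g -> closed [set x | f x <= g x].
Proof.
move=> cf cg; have cd := continuous_subr cg cf.
have := @preimage_closed X R _ [set r | 0 <= r] (fun x _ => cd x) (@closed_ge R 0).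
by congr closed; apply/seteqP; split => x /=; rewrite subr_ge0.
Qed.

Lemma closed_eq_continuous (R : realType) (X : topologicalType) (f g : X -> R) :
  continuous f -> continuous g -> closed [set x | f x = g x].
Proof.
move=> cf cg; have cd := continuous_subr cg cf.
have := @preimage_closed X R _ [set r | r = 0] (fun x _ => cd x) (@closed_eq R 0).
congr closed; apply/seteqP; split => x /=; last by move=> ->; rewrite subrr.
by move/eqP; rewrite subr_eq0 => /eqP.
Qed.

Section FormSpace.
Variables (R : realType) (T : finType).

(** Forms are stored as uncurried functions, so that their topology is a product
topology and Tychonoff's theorem applies. *)
Definition form_space : topologicalType :=
  prod_topology (fun _ : T * T => (R : topologicalType)).

Definition form_of (x : form_space) (a b : T) : R := x (a, b).

Lemma continuous_entry a b : continuous (fun x => form_of x a b).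
Proof.
exact: (@proj_continuous _ (fun _ : T * T => (R : topologicalType)) (a, b)).
Qed.

Lemma psd_base_compact :
  compact [set x | psd_form (form_of x) /\ form_trace (form_of x) <= 1].
Proof.
pose box := [set x : form_space | forall p, `[-1, 1]%classic (x p)].
have cbox : compact box.
  apply: (@tychonoff _ (fun _ : T * T => (R : topologicalType))
                     (fun=> `[-1, 1]%classic)).
  by move=> _; exact: segment_compact.
apply: (subclosed_compact _ cbox); last first.
  move=> x [px tx] [a b]; rewrite /= in_itv /= -ler_norml.
  exact: le_trans (psd_form_le_trace a b px) tx.
apply: closedI; first apply: closedI.
- apply: closed_forall => a; apply: closed_forall => b.
  by apply: closed_eq_continuous; exact: continuous_entry.
- apply: closed_forall => v; apply: closed_le_continuous.
    by exact: cst_continuous.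
  apply: continuous_sumr => a; apply: continuous_sumr => b.
  apply: continuous_mulr; last exact: continuous_entry.
  by exact: cst_continuous.
- apply: closed_le_continuous; last by exact: cst_continuous.
  by apply: continuous_sumr => a; exact: continuous_entry.
Qed.

End FormSpace.

(** Farkas' lemma for the cone of psd forms and the linear map
G |-> sum_(a, c) G a c *: t a c. The condition on the kernel is what makes the
image of the cone closed; without it, b could lie in the closure of the image
and neither alternative hold. *)
Lemma psd_alternative (R : realType) (T J : finType) (t : T -> T -> J -> R)
    (b : J -> R) :
  (forall G, psd_form G -> (forall j, \sum_a \sum_c G a c * t a c j = 0) ->
     form_trace G = 0) ->
  (exists2 G, psd_form G & forall j, \sum_a \sum_c G a c * t a c j = b j) \/
  (exists2 y : J -> R,
     forall G, psd_form G ->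
       0 <= \sum_j (\sum_a \sum_c G a c * t a c j) * y j
   & \sum_j b j * y j < 0).
Proof.
move=> ker0.
pose A (G : T -> T -> R) j := \sum_a \sum_c G a c * t a c j.
have AD l m G H j : A (fun a c => l * G a c + m * H a c) j = l * A G j + m * A H j.
  rewrite /A !mulr_sumr -big_split; apply: eq_bigr => a _ /=.
  by rewrite !mulr_sumr -big_split; apply: eq_bigr => c _ /=; ring.
have AZ l G j : A (fun a c => l * G a c) j = l * A G j.
  have := AD l 0 G (fun _ _ => 0) j; rewrite (mul0r (A _ _)) addr0 => <-.
  by apply: eq_bigr => a _; apply: eq_bigr => c _; rewrite mul0r addr0.
have trD l m (G H : T -> T -> R) : form_trace (fun a c => l * G a c + m * H a c) =
    l * form_trace G + m * form_trace H.
  by rewrite /form_trace !mulr_sumr -big_split.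
have [?|nob] := pselect (exists2 G, psd_form G & forall j, A G j = b j).
  by left.
right.
pose F (x : form_space R T) j :=
  A (form_of x) j - (1 - form_trace (form_of x)) * b j.
have := @convex_image_separation R _ J _ F (@psd_base_compact R T).
case.
- exists (fun=> 0); split; first exact: psd_form0.
  by rewrite /form_trace big1 // ler01.
- move=> j.
  have cst r : continuous (fun _ : form_space R T => r : R).
    by exact: cst_continuous.
  apply: continuous_subr; last first.
    apply: continuous_mulr; last exact: cst.
    apply: continuous_subr; first exact: cst.
    by apply: continuous_sumr => a; exact: continuous_entry.
  apply: continuous_sumr => a; apply: continuous_sumr => c.
  by apply: continuous_mulr; [exact: continuous_entry|exact: cst].
- move=> x x' l [px tx] [px' tx'] /andP[l0 l1].
  exists (fun p => (1 - l) * x p + l * x' p).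
    split; first by apply: (psd_formD _ _ px px'); lra.
    rewrite (trD _ _ (form_of x) (form_of x')).
    have : (1 - l) * form_trace (form_of x) <= (1 - l) * 1 by rewrite ler_wpM2l //; lra.
    have : l * form_trace (form_of x') <= l * 1 by rewrite ler_wpM2l.
    lra.
  move=> j; rewrite /F /form_of (AD _ _ (form_of x) (form_of x')).
  by rewrite (trD _ _ (form_of x) (form_of x')) -!/(form_of _); ring.
(* A zero of F with trace less than 1 would represent b, and one with trace 1
   would lie in the kernel. *)
- move=> x [px tx]; apply: contrapT => /forallNP F0.
  have {}F0 j : A (form_of x) j = (1 - form_trace (form_of x)) * b j.
    by apply/eqP; rewrite -subr_eq0; apply/negPn/negP; exact: F0.
  have [s0|s0] := eqVneq (1 - form_trace (form_of x)) 0.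
    have := ker0 (form_of x) px; rewrite -/(A (form_of x)) => tr0.
    have : form_trace (form_of x) = 0.
      by apply: tr0 => j; rewrite -/(A _ j) F0 s0 mul0r.
    by move/eqP: s0; rewrite subr_eq0 => /eqP <- /eqP; rewrite oner_eq0.
  have {}s0 : 0 < 1 - form_trace (form_of x) by rewrite lt_def s0 subr_ge0.
  apply: nob; exists (fun a c => (1 - form_trace (form_of x))^-1 * form_of x a c).
    by apply: psd_formZ => //; rewrite invr_ge0 ltW.
  by move=> j; rewrite AZ F0 mulKf // gt_eqF.
move=> y ypos; exists y => [G pG|].
  have tr0 : 0 <= form_trace G.
    by apply: sumr_ge0 => a _; apply: psd_form_diag.
  have [trG|trG] := eqVneq (form_trace G) 0.
    apply: sumr_ge0 => j _.
    rewrite big1 ?mul0r // => a _; rewrite big1 // => c _.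
    have := psd_form_le_trace a c pG; rewrite trG normr_le0 => /eqP ->.
    by rewrite mul0r.
  have {trG}tr0 : 0 < form_trace G by rewrite lt_def trG.
  have trZ : form_trace (fun a c => (form_trace G)^-1 * G a c) = 1.
    by rewrite /form_trace -mulr_sumr mulVf // gt_eqF.
  pose x := (fun p => (form_trace G)^-1 * G p.1 p.2)
    : form_space R T.
  have Bx : psd_form (form_of x) /\ form_trace (form_of x) <= 1.
    by split; [apply: psd_formZ; rewrite ?invr_ge0 ?ltW | rewrite trZ].
  have := ypos x Bx.
  have -> : \sum_j F x j * y j = (form_trace G)^-1 * \sum_j A G j * y j.
    rewrite mulr_sumr; apply: eq_bigr => j _.
    by rewrite /F trZ subrr mul0r subr0 /form_of (AZ _ G) mulrA.
  by rewrite pmulr_rgt0 ?invr_gt0 // => /ltW.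
(* the zero form is mapped to - b *)
pose o : form_space R T := fun=> 0.
have Bo : psd_form (form_of o) /\ form_trace (form_of o) <= 1.
  by split; [exact: psd_form0 | rewrite /form_trace big1 // ler01].
have := ypos o Bo.
have -> : \sum_j F o j * y j = - \sum_j b j * y j.
  rewrite -sumrN; apply: eq_bigr => j _.
  rewrite /F /form_trace [X in 1 - X]big1 // subr0 mul1r /A.
  rewrite big1 => [|a _]; last by rewrite big1 // => c _; rewrite mul0r.
  by rewrite sub0r mulNr.
by rewrite oppr_gt0.
Qed.

End Separation.

(** * Degrees and sums of squares of polynomials *)

From mathcomp Require Import mpoly.

Lemma seq_argmax (disp : Order.disp_t) (O : orderType disp) (T : eqType)
    (g : T -> O) (s : seq T) :
  s != [::] -> exists2 x, x \in s & forall z, z \in s -> (g z <= g x)%O.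
Proof.
elim: s => // p s IH _; have [->|/IH [q qs qmax]] := eqVneq s [::].
  by exists p; rewrite ?mem_seq1 // => r; rewrite mem_seq1 => /eqP ->.
have [pq|/ltW qp] := leP (g p) (g q).
  exists q; first by rewrite inE qs orbT.
  by move=> r; rewrite inE => /predU1P[->//|]; exact: qmax.
exists p; first by rewrite inE eqxx.
by move=> r; rewrite inE => /predU1P[->//|/qmax /le_trans]; apply.
Qed.

Section Degree.
Variables (R : realType) (n : nat).
Implicit Types (p q : {mpoly R[n]}) (s t : nat).

Lemma poly_deg_leP t p :
  poly_deg_le t p <-> forall m, m \in msupp p -> (mdeg m <= t)%N.
Proof.
rewrite /poly_deg_le /= msizeE; split => [/bigmax_leqP_seq h m mp|h].
  exact: h.
by apply/bigmax_leqP_seq => m mp _; exact: h.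
Qed.

Lemma poly_deg_le_trans s t p : (s <= t)%N -> poly_deg_le s p -> poly_deg_le t p.
Proof. by move=> st; rewrite /poly_deg_le /= => /leq_trans; apply. Qed.

Lemma poly_deg_leD t p q :
  poly_deg_le t p -> poly_deg_le t q -> poly_deg_le t (p + q).
Proof.
by move=> hp hq; apply: leq_trans (msizeD_le p q) _; rewrite geq_max hp.
Qed.

Lemma poly_deg_leZ t c p : poly_deg_le t p -> poly_deg_le t (c *: p).
Proof. exact: leq_trans (msizeZ_le p c). Qed.

Lemma poly_deg_leB t p q :
  poly_deg_le t p -> poly_deg_le t q -> poly_deg_le t (p - q).
Proof. by move=> hp hq; apply: poly_deg_leD; rewrite // /poly_deg_le /= msizeN. Qed.

Lemma poly_deg_leM s t p q :
  poly_deg_le s p -> poly_deg_le t q -> poly_deg_le (s + t) (p * q).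
Proof.
move=> /poly_deg_leP hp /poly_deg_leP hq; apply/poly_deg_leP => m.
move=> /msuppM_le /allpairsP [[a b] /= [ap bq ->]].
by rewrite mdegD leq_add ?hp ?hq.
Qed.

Lemma poly_deg_le_sum t (I : Type) (r : seq I) (F : I -> {mpoly R[n]}) :
  (forall i, poly_deg_le t (F i)) -> poly_deg_le t (\sum_(i <- r) F i).
Proof.
move=> hF; elim/big_ind: _ => //; last exact: poly_deg_leD.
by rewrite /poly_deg_le /= msize0.
Qed.

Lemma poly_deg_leC t c : poly_deg_le t (c%:MP_[n] : {mpoly R[n]}).
Proof. by apply: (@poly_deg_le_trans 0); rewrite // /poly_deg_le /= msizeC; case: eqP. Qed.

Lemma poly_deg_leX t p j : poly_deg_le t p -> poly_deg_le (j * t) (p ^+ j).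
Proof.
move=> hp; elim: j => [|j IH]; first exact: poly_deg_leC.
by rewrite exprS mulSn; apply: poly_deg_leM.
Qed.

Lemma poly_deg_le_theta : poly_deg_le 2 (theta R n).
Proof.
apply: poly_deg_leD; first exact: poly_deg_leC.
apply: poly_deg_le_sum => i; apply: (@poly_deg_leX 1).
by rewrite /poly_deg_le /= msizeX mdeg1.
Qed.

Lemma mpoly_deg_eq t p q : poly_deg_le t p -> poly_deg_le t q ->
  (forall m : 'X_{1..n < t.+1}, p@_m = q@_m) -> p = q.
Proof.
move=> hp hq pq; apply/mpolyP => m.
have [lt|ge] := ltnP (mdeg m) t.+1; first exact: (pq (BMultinom lt)).
by rewrite !memN_msupp_eq0 //; apply: msize_mdeg_ge; exact: leq_trans ge.
Qed.

(** Let m be the largest leading monomial of the nonzero terms r. The coefficient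
of 2 m in the sum is the sum of the squares of the coefficients of m in the
r, which is positive. *)
Lemma sum_sqr_mlead (s : seq {mpoly R[n]}) q : q \in s -> q != 0 ->
  exists2 m, (mlead q <= m)%O & (m + m)%MM \in msupp (\sum_(r <- s) r ^+ 2).
Proof.
move=> qs q0.
pose s' := [seq r <- s | r != 0].
have qs' : q \in s' by rewrite mem_filter q0.
have [|r rs' rmax] := @seq_argmax _ _ _ (@mlead n R) s'.
  by apply: contraTneq qs' => ->.
have r0 : r != 0 by move: rs'; rewrite mem_filter => /andP[].
exists (mlead r); first exact: rmax.
have -> : \sum_(r <- s) r ^+ 2 = \sum_(r <- s') r ^+ 2.
  rewrite big_filter [LHS](bigID (fun r => r != 0)) /= [X in _ + X]big1 ?addr0 //.
  by move=> i /negPn /eqP ->; rewrite expr0n.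
rewrite mcoeff_msupp raddf_sum /= big_seq.
under eq_bigr => i is' do rewrite expr2 mleadcMW ?rmax // -expr2.
rewrite -big_seq psumr_neq0; last by move=> i _; exact: sqr_ge0.
by apply/hasP; exists r => //=; rewrite exprn_even_gt0 ?mleadc_eq0.
Qed.

Lemma sum_sqr_eq0 (s : seq {mpoly R[n]}) :
  \sum_(r <- s) r ^+ 2 = 0 -> forall q, q \in s -> q = 0.
Proof.
move=> s0 q qs; apply/eqP/negPn/negP => /(sum_sqr_mlead qs) [m _].
by rewrite s0 msupp0.
Qed.

Lemma sum_sqr_deg t (s : seq {mpoly R[n]}) :
  poly_deg_le (2 * t) (\sum_(r <- s) r ^+ 2) ->
  forall q, q \in s -> poly_deg_le t q.
Proof.
move=> /poly_deg_leP hs q qs.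
have [->|q0] := eqVneq q 0; first by rewrite /poly_deg_le /= msize0.
have [m /lemc_mdeg qm /hs] := sum_sqr_mlead qs q0.
rewrite mdegD addnn -mul2n leq_pmul2l // => mt.
by rewrite /poly_deg_le /= -mlead_deg // ltnS (leq_trans qm).
Qed.

Lemma sos_sqr t p : poly_deg_le t p -> sos t (p ^+ 2).
Proof. by move=> hp; split; [exact: poly_deg_leX|exists [:: p]; rewrite big_seq1]. Qed.

Lemma sosM s t p q : sos s p -> sos t q -> sos (s + t) (p * q).
Proof.
move=> [dp [u pE]] [dq [v qE]]; split; first by rewrite mulnDr; apply: poly_deg_leM.
exists [seq a * b | a <- u, b <- v].
rewrite big_allpairs_dep pE qE mulr_suml; apply: eq_bigr => a _.
by rewrite mulr_sumr; apply: eq_bigr => b _; rewrite exprMn.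
Qed.

Lemma sos_theta : sos 1 (theta R n).
Proof.
split; first exact: poly_deg_le_theta.
exists (1 :: [seq 'X_i | i <- enum 'I_n]).
by rewrite big_cons expr1n big_map big_enum.
Qed.

Lemma sos_thetaX j : sos j (theta R n ^+ j).
Proof.
elim: j => [|j IH]; first by rewrite expr0 -(expr1n _ 2); apply/sos_sqr/poly_deg_leC.
by rewrite exprS -add1n; apply: sosM => //; exact: sos_theta.
Qed.

Lemma sos_le s t p : (s <= t)%N -> sos s p -> sos t p.
Proof.
by move=> st [dp ?]; split => //; apply: poly_deg_le_trans dp; rewrite leq_pmul2l.
Qed.

Lemma mcoeff_mul t p q m : poly_deg_le t p -> poly_deg_le t q ->
  (p * q)@_m = \sum_(a : 'X_{1..n < t.+1}) \sum_(c : 'X_{1..n < t.+1})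
    p@_a * q@_c * ((a + c)%MM == m)%:R.
Proof.
move=> hp hq; rewrite (mpolywME hp hq) raddf_sum /= pair_bigA /=.
by apply: eq_bigr => -[a c] _; rewrite mcoeffZ mcoeffX.
Qed.

End Degree.

(** * Riesz functionals and moment matrices *)

Section Riesz.
Variables (R : realType) (n : nat).

Section AnyBound.
Variable b : nat.
Implicit Types (y z : trunc_seq R n b) (p q : {mpoly R[n]}).

Lemma rieszB y p q : riesz y (p - q) = riesz y p - riesz y q.
Proof. by rewrite /riesz -sumrB; apply: eq_bigr => m _; rewrite mcoeffB mulrBl. Qed.

Lemma rieszZ y c p : riesz y (c *: p) = c * riesz y p.
Proof. by rewrite /riesz mulr_sumr; apply: eq_bigr => m _; rewrite mcoeffZ mulrA. Qed.

Lemma riesz_sum y (I : Type) (r : seq I) (F : I -> {mpoly R[n]}) :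
  riesz y (\sum_(i <- r) F i) = \sum_(i <- r) riesz y (F i).
Proof.
rewrite /riesz exchange_big /=; apply: eq_bigr => m _.
by rewrite raddf_sum mulr_suml.
Qed.

Lemma riesz_comb y z c d p :
  riesz [ffun m => c * y m + d * z m] p = c * riesz y p + d * riesz z p.
Proof.
rewrite /riesz !mulr_sumr -big_split; apply: eq_bigr => m _ /=.
by rewrite ffunE; ring.
Qed.

End AnyBound.

Variable t : nat.
Implicit Types (y : trunc_seq R n (2 * t)) (p q : {mpoly R[n]}).

Lemma riesz_mul y p q : poly_deg_le t p -> poly_deg_le t q ->
  riesz y (p * q) = \sum_(a : 'X_{1..n < t.+1}) \sum_(c : 'X_{1..n < t.+1})
    p@_a * q@_c * y (bmnm_add a c).
Proof.
move=> hp hq; rewrite /riesz.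
under eq_bigr do rewrite (mcoeff_mul _ hp hq) mulr_suml.
rewrite exchange_big; apply: eq_bigr => a _ /=.
under eq_bigr do rewrite mulr_suml.
rewrite exchange_big; apply: eq_bigr => c _ /=.
rewrite (bigD1 (bmnm_add a c)) //= eqxx mulr1 big1 ?addr0 // => m mac.
by rewrite [(_ == _)]negbTE ?mulr0 ?mul0r // eq_sym.
Qed.

Lemma moment_mxP y :
  psdmx (moment_mx y) <->
  forall w : 'X_{1..n < t.+1} -> R,
    0 <= \sum_a \sum_c w a * w c * y (bmnm_add a c).
Proof.
have E (w : 'X_{1..n < t.+1} -> R) (v : 'rV[R]_#|{: 'X_{1..n < t.+1}}|) :
    (forall i, v 0 i = w (enum_val i)) ->
    (v *m moment_mx y *m v^T) 0 0 = \sum_a \sum_c w a * w c * y (bmnm_add a c).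
  move=> vw; rewrite mxE.
  under eq_bigr do rewrite mxE mulr_suml.
  have enumE F : \sum_(a : 'X_{1..n < t.+1}) F a =
      \sum_(i < #|{: 'X_{1..n < t.+1}}|) F (enum_val i) :> R.
    by rewrite -big_enum_val; apply: eq_bigl.
  rewrite exchange_big enumE; apply: eq_bigr => i _ /=.
  by rewrite enumE; apply: eq_bigr => j _; rewrite !mxE !vw mulrAC.
split=> [[_ pos] w|pos].
  by rewrite -(E w (\row_i w (enum_val i))) // => i; rewrite mxE.
split.
  by apply/matrixP => i j; rewrite !mxE; congr (y _); apply/val_inj; rewrite /= addmC.
move=> v; rewrite (E (fun a => v 0 (enum_rank a))) // => i.
by rewrite enum_valK.
Qed.

Lemma riesz_sos_ge0 y p : psdmx (moment_mx y) -> sos t p -> 0 <= riesz y p.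
Proof.
move=> /moment_mxP pos [dp [s pE]]; rewrite pE riesz_sum big_seq.
apply: sumr_ge0 => q qs; have dq : poly_deg_le t q.
  by apply: sum_sqr_deg qs; rewrite -pE.
by rewrite expr2 riesz_mul.
Qed.

Lemma moment_mx_comb y z c d : 0 <= c -> 0 <= d ->
  psdmx (moment_mx y) -> psdmx (moment_mx z) ->
  psdmx (moment_mx [ffun m => c * y m + d * z m]).
Proof.
move=> c0 d0 /moment_mxP py /moment_mxP pz; apply/moment_mxP => w.
have -> : \sum_a \sum_e w a * w e *
      [ffun m => c * y m + d * z m] (bmnm_add a e) =
    c * (\sum_a \sum_e w a * w e * y (bmnm_add a e)) +
    d * (\sum_a \sum_e w a * w e * z (bmnm_add a e)).
  rewrite !mulr_sumr -big_split; apply: eq_bigr => a _ /=.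
  rewrite !mulr_sumr -big_split; apply: eq_bigr => e _ /=.
  by rewrite ffunE; ring.
by rewrite addr_ge0 // mulr_ge0.
Qed.

Definition poly_of_coefs (v : 'X_{1..n < t.+1} -> R) : {mpoly R[n]} :=
  \sum_a v a *: 'X_[a].

Lemma mcoeff_poly_of_coefs v (a : 'X_{1..n < t.+1}) : (poly_of_coefs v)@_a = v a.
Proof.
rewrite raddf_sum (bigD1 a) //= mcoeffZ mcoeffX eqxx mulr1 big1 ?addr0 //.
by move=> c ca; rewrite mcoeffZ mcoeffX -bmeqP (negPf ca) mulr0.
Qed.

Lemma poly_deg_le_poly_of_coefs v : poly_deg_le t (poly_of_coefs v).
Proof.
apply: poly_deg_le_sum => a; apply: poly_deg_leZ.
by rewrite /poly_deg_le /= msizeX bmdeg.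
Qed.

Definition gram_coef (a c : 'X_{1..n < t.+1}) (j : 'X_{1..n < (2 * t).+1}) : R :=
  (bmnm_add a c == j)%:R.

(** Each rank-one term of psd_form_sum_rank1 is the Gram matrix of one square. The
last conclusion serves to recover the trace of G from the terms of the sum. *)
Lemma gram_sum_sqr G : psd_form G ->
  exists s : seq {mpoly R[n]},
    [/\ forall j : 'X_{1..n < (2 * t).+1},
          (\sum_(q <- s) q ^+ 2)@_j = \sum_a \sum_c G a c * gram_coef a c j,
        poly_deg_le (2 * t) (\sum_(q <- s) q ^+ 2) &
        forall a : 'X_{1..n < t.+1}, G a a = \sum_(q <- s) q@_a ^+ 2].
Proof.
move=> /psd_form_sum_rank1 [s GE]; exists (map poly_of_coefs s); split.
- move=> j; rewrite big_map raddf_sum /=.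
  under eq_bigr do rewrite expr2
    (mcoeff_mul _ (poly_deg_le_poly_of_coefs _) (poly_deg_le_poly_of_coefs _)).
  rewrite exchange_big; apply: eq_bigr => a _ /=.
  rewrite exchange_big; apply: eq_bigr => c _ /=.
  rewrite GE mulr_suml; apply: eq_bigr => v _.
  by rewrite !mcoeff_poly_of_coefs /gram_coef bmeqP.
- rewrite big_map; apply: poly_deg_le_sum => v.
  exact: (poly_deg_leX 2 (poly_deg_le_poly_of_coefs v)).
- move=> a; rewrite GE big_map; apply: eq_bigr => v _.
  by rewrite mcoeff_poly_of_coefs expr2.
Qed.

(** This is psd_alternative for the Gram map. Its kernel condition holds because
a sum of squares vanishes only if all its terms do. *)
Lemma sos_alternative p : poly_deg_le (2 * t) p ->
  sos t p \/
  exists2 y : trunc_seq R n (2 * t), psdmx (moment_mx y) & riesz y p < 0.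
Proof.
move=> dp.
have [G pG G0|[G pG GE]|[y ypos yp]] :=
    @psd_alternative R _ _ gram_coef (fun j => p@_j).
- have [s [sE ds trE]] := gram_sum_sqr pG.
  have s0 : \sum_(q <- s) q ^+ 2 = 0.
    apply: (mpoly_deg_eq ds) => [|j]; first by rewrite /poly_deg_le /= msize0.
    by rewrite sE G0 mcoeff0.
  rewrite /form_trace big1 // => a _; rewrite trE big_seq big1 // => q qs.
  by rewrite (sum_sqr_eq0 s0 qs) mcoeff0 expr0n.
- left; split=> //; have [s [sE ds _]] := gram_sum_sqr pG.
  by exists s; apply: (mpoly_deg_eq dp ds) => j; rewrite sE GE.
right; exists (finfun y); last first.
  by rewrite /riesz; under eq_bigr do rewrite ffunE.
(* nonnegativity on the rank-one form w w^T is the moment inequality at w *)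
apply/moment_mxP => w.
have psd_w : psd_form (fun a c => w a * w c).
  split=> [a c|v]; first by rewrite mulrC.
  have -> : \sum_a \sum_b v a * v b * (w a * w b) = (\sum_a v a * w a) ^+ 2.
    rewrite expr2 mulr_suml; apply: eq_bigr => a _.
    by rewrite mulr_sumr; apply: eq_bigr => b _; ring.
  exact: sqr_ge0.
have := ypos _ psd_w.
congr (0 <= _); under eq_bigr do rewrite mulr_suml.
rewrite exchange_big; apply: eq_bigr => a _ /=.
under eq_bigr do rewrite mulr_suml.
rewrite exchange_big; apply: eq_bigr => c _ /=.
rewrite (bigD1 (bmnm_add a c)) //= /gram_coef eqxx mulr1 ffunE big1 ?addr0 //.
by move=> j /negPf jac; rewrite eq_sym jac mulr0 mul0r.
Qed.

(** The moments of the Dirac mass at the origin. *)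
Definition eval0_seq : trunc_seq R n (2 * t) :=
  [ffun m : 'X_{1..n < (2 * t).+1} => ((m : 'X_{1..n}) == 0%MM)%:R].

Lemma riesz_eval0 p : riesz eval0_seq p = p@_0%MM.
Proof.
have lt0 : (mdeg (0%MM : 'X_{1..n}) < (2 * t).+1)%N by rewrite mdeg0.
rewrite /riesz (bigD1 (BMultinom lt0)) //= ffunE eqxx mulr1 big1 ?addr0 //.
by move=> m; rewrite bmeqP ffunE /= => /negPf ->; rewrite mulr0.
Qed.

Lemma psd_eval0 : psdmx (moment_mx eval0_seq).
Proof.
apply/moment_mxP => w.
have -> : \sum_a \sum_c w a * w c * eval0_seq (bmnm_add a c) =
    (\sum_a w a * ((a : 'X_{1..n}) == 0%MM)%:R) ^+ 2.
  rewrite expr2 mulr_suml; apply: eq_bigr => a _.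
  rewrite mulr_sumr; apply: eq_bigr => c _.
  rewrite ffunE /= mnmD_eq0.
  by case: eqP; case: eqP => //= _ _; rewrite !(mulr0, mul0r, mulr1).
exact: sqr_ge0.
Qed.

End Riesz.

Lemma mcoeff0_theta (R : realType) n : (theta R n)@_0%MM = 1.
Proof.
rewrite /theta mcoeffD mcoeff1 eqxx raddf_sum big1 ?addr0 // => i _.
by rewrite /= mcoeffXn -mdeg_eq0 mdegMn mdeg1.
Qed.

(** * Duality *)

Section Duality.
Variables (R : realType) (n d k : nat) (f : {mpoly R[n]}) (eps : R).
Hypothesis f_deg : poly_deg_le (2 * d) f.

Definition dual_objective := theta R n ^+ k * (f + eps *: theta R n ^+ d).

Lemma dual_objective_shift l :
  theta R n ^+ k * (f - l%:MP + eps *: theta R n ^+ d) =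
  dual_objective - l *: theta R n ^+ k.
Proof. by rewrite /dual_objective -mul_mpolyC; ring. Qed.

Lemma poly_deg_le_shift l :
  poly_deg_le (2 * (k + d)) (dual_objective - l *: theta R n ^+ k).
Proof.
have dth j : poly_deg_le (2 * j) (theta R n ^+ j).
  by rewrite mulnC; apply: poly_deg_leX; exact: poly_deg_le_theta.
apply: poly_deg_leB; last first.
  by apply/poly_deg_leZ/poly_deg_le_trans/dth; rewrite leq_pmul2l // leq_addr.
by rewrite mulnDr; apply/poly_deg_leM/poly_deg_leD/poly_deg_leZ.
Qed.

Lemma weak_duality l y :
  rho_feasible d k f eps l -> tau_feasible R n d k y ->
  l <= riesz y dual_objective.
Proof.
rewrite /rho_feasible /= dual_objective_shift => hl [py y1].
by have := riesz_sos_ge0 py hl; rewrite rieszB rieszZ y1 mulr1 subr_ge0.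
Qed.

Lemma tau_feasible_eval0 : tau_feasible R n d k (eval0_seq R n (k + d)).
Proof.
split; first exact: psd_eval0.
by rewrite riesz_eval0 rmorphXn /= mcoeff0_theta expr1n.
Qed.

(** The separating functional y may vanish on theta^k, in which case it cannot be
normalised and is only a recession direction of the dual feasible set. Combining
it with the Dirac mass at the origin covers both cases. *)
Lemma rho_feasible_lower_bound r :
  (forall y, tau_feasible R n d k y -> r <= riesz y dual_objective) ->
  rho_feasible d k f eps r.
Proof.
move=> lb; rewrite /rho_feasible /= dual_objective_shift.
have [//|[y py]] := sos_alternative (poly_deg_le_shift r).
rewrite rieszB rieszZ; set ya := riesz y (theta R n ^+ k).
have ya0 : 0 <= ya.
  by apply: riesz_sos_ge0 py _; apply: sos_le (sos_thetaX R n k); rewrite leq_addr.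
have [p0 e1] := tau_feasible_eval0.
have feas c e : 0 <= c -> 0 <= e -> c * ya + e = 1 ->
    r <= c * riesz y dual_objective +
         e * riesz (eval0_seq R n (k + d)) dual_objective.
  move=> c0 e0 ce; rewrite -riesz_comb; apply: lb; split.
    exact: moment_mx_comb.
  by rewrite riesz_comb e1 mulr1.
have [ya_gt0 | ya_le0] := ltP 0 ya => neg.
  (* y / L_y(theta^k) is dual feasible *)
  have := feas ya^-1 0; rewrite mul0r !addr0 invr_ge0 mulVf ?gt_eqF //.
  move=> /(_ ya0 (lexx _) erefl); rewrite mulrC ler_pdivlMr //; lra.
have {ya_le0}ya_eq0 : ya = 0 by lra.
move: neg; rewrite ya_eq0 mulr0 subr0 => neg.
pose v := riesz (eval0_seq R n (k + d)) dual_objective.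
(* large enough to bring the value v at the origin below r *)
pose c := (`|v - r| + 1) / - riesz y dual_objective.
have c0 : 0 <= c by rewrite divr_ge0 ?addr_ge0 // oppr_ge0 ltW.
have := feas c 1 c0 ler01; rewrite ya_eq0 mulr0 add0r => /(_ erefl).
have -> : c * riesz y dual_objective = - (`|v - r| + 1) by rewrite /c; field; lra.
by rewrite mul1r -/v; have := ler_norm (v - r); lra.
Qed.

End Duality.

Theorem proposition4p1 (R : realType) (n d k : nat) (f : {mpoly R[n]}) (eps : R)
    (f_deg : poly_deg_le (2 * d) f)
    (f_bnd : (ENInf R < ereal_inf [set EFin f.@[x] | x in [set: 'I_n -> R]])%O)
    (eps_gt0 : 0 < eps) :
  rho d k f eps = tau d k f eps /\
  ((ENInf R < tau d k f eps)%O ->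
   exists2 l : R, rho_feasible d k f eps l & EFin l = rho d k f eps).
Proof.
have tau_le y : tau_feasible R n d k y -> (tau d k f eps <=
    EFin (riesz y (theta R n ^+ k * (f + eps *: theta R n ^+ d))))%O.
  by move=> hy; apply: ereal_inf_lbound; exists y.
have rho_le_tau : (rho d k f eps <= tau d k f eps)%O.
  apply: ge_ereal_sup => _ [l hl <-]; apply: le_ereal_inf_tmp => _ [y hy <-].
  by rewrite lee_fin; exact: weak_duality hl hy.
have := tau_le _ (tau_feasible_eval0 R n d k).
case tauE : (tau d k f eps) => [r||] // _; last first.
  by split; [apply/eqP; rewrite -leeNy_eq -tauE | rewrite ltxx].
have hr : rho_feasible d k f eps r.
  apply: rho_feasible_lower_bound => // y /tau_le.
  by rewrite tauE lee_fin.
have rhoE : rho d k f eps = EFin r.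
  apply/eqP; rewrite eq_le -{1}tauE rho_le_tau /=.
  by apply: ereal_sup_ubound; exists r.
by split=> // _; exists r.
Qed.
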